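(* Let $q$ be a power of a prime $p$, and let $A$ be an invertible $k\times k$ matrix over $\mathbb{F}_q$. Let $k_1<k_2<\cdots<k_N$ be the (distinct) degrees of the irreducible factors over $\mathbb{F}_q$ of the characteristic polynomial of $A$, and let $Q=Q(A)$ be the least common multiple of the numbers $q^{k_j}-1$, $j=1,\dots,N$. Consider the linear system $\mathbf{v}_{n+1}=A\mathbf{v}_n$, $n=0,1,2,\dots$, over $\mathbb{F}_q$, with $\mathbf{v}_0\in\mathbb{F}_q^k$. (i) If every irreducible factor of the characteristic polynomial of $A$ has multiplicity $1$, then every solution of $\mathbf{v}_{n+1}=A\mathbf{v}_n$ is $Q$-periodic. In particular, if the characteristic polynomial of $A$ is irreducible over $\mathbb{F}_q$, then $q^k-1$ is a common period of all solutions of $\mathbf{v}_{n+1}=A\mathbf{v}_n$. (ii) If some irreducible factor of the characteristic polynomial of $A$ has multiplicity larger than $1$, then every solution of $\mathbf{v}_{n+1}=A\mathbf{v}_n$ is $Qp^{r+1}$-periodic, where the exponent $r$ is determined by writing $k-1=\kappa_0+\kappa_1p+\cdots+\kappa_rp^r$ in base $p$ with $0\le\kappa_i<p$ for all $i$ and $0<\kappa_r<p$.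
   Context: A sequence $(\mathbf{v}_n)_{n\ge0}$ is called $T$-periodic (and $T$ is a period of it) if $T\ge 1$ and $\mathbf{v}_{n+T}=\mathbf{v}_n$ for all $n\ge 0$; $T$ need not be the minimal period. *)

(* Defs.v *)
From mathcomp Require Import all_boot all_order all_algebra.

Set Implicit Arguments.
Unset Strict Implicit.
Unset Printing Implicit Defensive.

Import GRing.Theory.
Local Open Scope ring_scope.

Definition periodic (V : Type) (v : nat -> V) (T : nat) : Prop :=
  (1 <= T)%N /\ forall n : nat, v (n + T)%N = v n.

Definition linear_solution (F : fieldType) (k : nat) (A : 'M[F]_k)
    (v : nat -> 'cV[F]_k) : Prop :=
  forall n : nat, v n.+1 = A *m v n.

(* Factors are not normalized to be monic: degree and multiplicity do not
   change when a factor is multiplied by a nonzero constant. *)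
Definition irreducible_factor (F : fieldType) (f g : {poly F}) : Prop :=
  irreducible_poly f /\ f %| g.

(* For f nonconstant and g != 0, f ^+ m %| g forces m < size g, so the maximum
   runs over all exponents m such that f ^+ m divides g. *)
Definition multiplicity (F : fieldType) (f g : {poly F}) : nat :=
  \max_(m < size g | f ^+ m %| g) m.

(* ks is the list k_1 < ... < k_N of the distinct degrees of the irreducible
   factors of g; this determines ks uniquely when g != 0. *)
Definition irreducible_factor_degrees (F : fieldType) (g : {poly F})
    (ks : seq nat) : Prop :=
  sorted ltn ks /\
  forall d : nat,
    d \in ks <-> exists2 f : {poly F}, irreducible_factor f g & (size f).-1 = d.

Definition lcm_period (q : nat) (ks : seq nat) : nat :=
  \big[lcmn/1%N]_(d <- ks) (q ^ d - 1)%N.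

Definition base_expansion (p n r : nat) (kappa : nat -> nat) : Prop :=
  [/\ n = (\sum_(i < r.+1) kappa i * p ^ i)%N,
      forall i : nat, (i <= r)%N -> (kappa i < p)%N
    & (0 < kappa r)%N].

(* Main.v *)
Require Import Defs.
From mathcomp Require Import all_boot all_order all_algebra.
From mathcomp Require Import fieldext finfield.

(** If the characteristic polynomial chi of A divides X^T - 1, then A^T = 1 by
Cayley-Hamilton, and every solution v_n = A^n v_0 has period T
(linear_solution_periodic). So each claim is a divisibility of polynomials.

Let f be an irreducible factor of chi of degree d. A root z of f generates a
field with q^d elements, in which z^(q^d) = z, and z is nonzero because A is
invertible; hence f divides X^(q^d - 1) - 1 (irreducible_dvdp_XexpB1), which
divides X^Q - 1. When chi itself is irreducible, d = k and this is all.

In general a polynomial g divides h as soon as every power of an irreducible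
polynomial that divides g also divides h (dvdp_irreducible_powers). If chi is
square-free, only first powers occur, and chi divides X^Q - 1. With
repeated factors, a power f^j that divides chi has j <= deg chi = k <= p^(r+1),
so it divides (X^Q - 1)^(p^(r+1)), which is X^(Q p^(r+1)) - 1 in
characteristic p. *)

Set Implicit Arguments.
Unset Strict Implicit.
Unset Printing Implicit Defensive.

Import GRing.Theory.
Local Open Scope ring_scope.

Lemma leq_exp_dvdp (F : fieldType) (f g : {poly F}) (j : nat) :
  (1 < size f)%N -> g != 0 -> f ^+ j %| g -> (j < size g)%N.
Proof.
move=> f_gt1 g_neq0 fj_g.
have fj_gt0 : (0 < size (f ^+ j))%N.
  by rewrite size_poly_gt0 expf_neq0 // -size_poly_gt0 ltnW.
have le_j : (j <= (size (f ^+ j)).-1)%N.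
  by rewrite size_exp leq_pmull // -ltnS prednK // ltnW.
by apply: leq_trans (dvdp_leq g_neq0 fj_g); rewrite -(prednK fj_gt0) ltnS.
Qed.

Lemma leq_multiplicity (F : fieldType) (f g : {poly F}) (j : nat) :
  (1 < size f)%N -> g != 0 -> f ^+ j %| g -> (j <= multiplicity f g)%N.
Proof.
move=> f_gt1 g_neq0 fj_g; have ltj := leq_exp_dvdp f_gt1 g_neq0 fj_g.
exact: (@leq_bigmax_cond _ _ _ (Ordinal ltj)).
Qed.

(** Irreducibility is not decidable over an arbitrary field, so the existence of
an irreducible divisor is stated with a double negation; this suffices to prove
a boolean goal such as a divisibility. *)
Lemma irreducible_divisor_not_none (F : fieldType) (g : {poly F}) :
  (1 < size g)%N ->
  ~ (forall f : {poly F}, irreducible_poly f -> ~~ (f %| g)).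
Proof.
have [n] := ubnP (size g); elim: n g => // n IHn g /ltnSE-le_g g_gt1 no_f.
have g_neq0 : g != 0 by rewrite -size_poly_gt0 ltnW.
suff g_irr : irreducible_poly g by have := no_f g g_irr; rewrite dvdpp.
split=> // d d_neq1 d_g; apply: contraT => nd_eqp.
have lt_dg : (size d < size g)%N.
  by rewrite ltn_neqAle dvdp_leq // andbT dvdp_size_eqp.
case: (IHn d) => [||f f_irr]; first exact: leq_trans lt_dg le_g.
  by rewrite ltn_neqAle eq_sym d_neq1 size_poly_gt0 (dvdpN0 d_g).
by apply: contra (no_f f f_irr) => /dvdp_trans; apply.
Qed.

(** This replaces unique factorization. If g does not divide h, write
g = u * gcd(g, h) with u nonconstant and take an irreducible divisor f of u.
Whenever f^j divides g it divides h, hence gcd(g, h), hence f^(j+1) divides g: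
all powers of f would divide g. *)
Lemma dvdp_irreducible_powers (F : fieldType) (g h : {poly F}) :
    g != 0 ->
    (forall (f : {poly F}) (j : nat),
       irreducible_poly f -> f ^+ j %| g -> f ^+ j %| h) ->
  g %| h.
Proof.
move=> g_neq0 pow_gh; apply: contraT => ngh.
have g_eq : g = g %/ gcdp g h * gcdp g h by rewrite divpK // dvdp_gcdl.
have u_neq0 : g %/ gcdp g h != 0.
  by apply: contraNneq g_neq0 => u0; rewrite g_eq u0 mul0r.
have u_gt1 : (1 < size (g %/ gcdp g h)%R)%N.
  rewrite ltn_neqAle size_poly_gt0 u_neq0 andbT eq_sym.
  apply: contra ngh => u_unit; rewrite {1}g_eq.
  apply: dvdp_trans (dvdp_gcdr g h); rewrite -[X in _ %| X]mul1r.
  by rewrite dvdp_mul2r ?gcdp_eq0 ?(negPf g_neq0) // dvdp1.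
case: (irreducible_divisor_not_none u_gt1) => f f_irr; apply/negP => f_u.
have pow_g j : f ^+ j %| g.
  elim: j => [|j fj_g]; first by rewrite expr0 dvd1p.
  by rewrite exprS {1}g_eq dvdp_mul // dvdp_gcd fj_g pow_gh.
by have := leq_exp_dvdp (fst f_irr) g_neq0 (pow_g (size g)); rewrite ltnn.
Qed.

(** Adjoining a root z of f gives a field with q^d elements, where d is the
degree of f, so z is a common root of f and X^(q^d) - X, and these are not
coprime. Being irreducible, f divides X * (X^(q^d - 1) - 1), and it is coprime
to X. *)
Lemma irreducible_dvdp_XexpB1 (F : finFieldType) (f : {poly F}) :
    irreducible_poly f -> ~~ root f 0 ->
  f %| 'X^(#|F| ^ (size f).-1 - 1) - 1.
Proof.
move=> f_irr f0; have [L dimL [z z_root _]] := irredp_FAdjoin f_irr.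
have cardL : #|finvect_type L| = (#|F| ^ (size f).-1)%N.
  rewrite -dimL -(card_vspace (fullv : {vspace finvect_type L})).
  by apply: eq_card => x; rewrite memvf.
have cf : f %| 'X^(#|F| ^ (size f).-1) - 'X.
  apply: contraT; rewrite -irreducible_poly_coprime //.
  rewrite -(coprimep_map (GRing.in_alg L)) => /coprimep_root /(_ z_root).
  rewrite rmorphB /= map_polyXn map_polyX !hornerE -cardL.
  by have := expf_card (z : finvect_type L) => /= ->; rewrite subrr eqxx.
have q_gt0 : (0 < #|F| ^ (size f).-1)%N.
  by rewrite expn_gt0 ltnW // finNzRing_gt1.
(* Only q^d > 0 matters from here on: q^d = m.+1 turns X^(q^d) into X * X^m. *)
case: (#|F| ^ _)%N q_gt0 cf => // m _; rewrite subn1 /= exprS.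
by rewrite -[X in _ - X]mulr1 -mulrBr Gauss_dvdpr // coprimepX.
Qed.

Lemma dvdp_XexpB1 (R : idomainType) (m n : nat) :
  (m %| n)%N -> ('X^m - 1 : {poly R}) %| 'X^n - 1.
Proof. by case/dvdnP=> d ->; rewrite mulnC exprM (subrX1 'X^m d) dvdp_mulIl. Qed.

Lemma exprB_pchar (R : comNzRingType) (p n : nat) (x y : R) :
  p \in [pchar R] -> (x - y) ^+ (p ^ n) = x ^+ (p ^ n) - y ^+ (p ^ n).
Proof.
move=> pR; elim: n => [|n IHn]; first by rewrite !expr1.
rewrite expnSr !exprM IHn -!(pFrobenius_autE pR) pFrobenius_autB_comm //.
exact: mulrC.
Qed.

Lemma dvdn_biglcm_seq (I : eqType) (s : seq I) (G : I -> nat) (d : I) :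
  d \in s -> (G d %| \big[lcmn/1%N]_(i <- s) G i)%N.
Proof. by move=> ds; rewrite (big_rem d) //= dvdn_lcml. Qed.

(** This is where the exponent r + 1 comes from: for n = k - 1 it gives
k <= p^(r+1), and k bounds every multiplicity. *)
Lemma base_expansion_ltn (p n r : nat) (kappa : nat -> nat) :
  (0 < p)%N -> base_expansion p n r kappa -> (n < p ^ r.+1)%N.
Proof.
move=> p_gt0 [-> lt_p _]; elim: r lt_p => [|r IHr] lt_p.
  by rewrite big_ord_recl big_ord0 addn0 muln1 lt_p.
rewrite big_ord_recr /= [X in (_ < X)%N]expnS.
apply: (@leq_trans ((kappa r.+1).+1 * p ^ r.+1)%N); last first.
  by rewrite leq_mul2r lt_p // orbT.
by rewrite mulSn ltn_add2r; apply: IHr => i le_ir; apply/lt_p/leqW.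
Qed.

Lemma linear_solution_periodic (F : fieldType) (k T : nat) (A : 'M[F]_k) :
    (0 < T)%N -> char_poly A %| 'X^T - 1 ->
  forall v : nat -> 'cV[F]_k, linear_solution A v -> periodic v T.
Proof.
case: k A => [|k] A T_gt0 A_dvd v v_sol; split=> // n.
  (* Column vectors of height 0 are all equal; from here on the size is k.+1,
     for which square matrices form a ring. *)
  by rewrite [LHS]flatmx0 [RHS]flatmx0.
have AT1 : A ^+ T = 1.
  apply/eqP; rewrite -subr_eq0 -[A in A ^+ T]horner_mx_X -rmorphXn /=.
  rewrite -(rmorph1 (horner_mx A)) -rmorphB /= -dvd_mxminpoly.
  exact: dvdp_trans (mxminpoly_dvd_char A) A_dvd.
have v_pow m : v (n + m)%N = A ^+ m *m v n.
  elim: m => [|m IHm]; first by rewrite addn0 mul1mx.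
  by rewrite addnS v_sol IHm mulmxA exprS.
by rewrite v_pow AT1 mul1mx.
Qed.

Lemma char_poly_neq0 (F : fieldType) (k : nat) (A : 'M[F]_k) :
  char_poly A != 0.
Proof. by rewrite monic_neq0 // char_poly_monic. Qed.

(** The constant coefficient of the characteristic polynomial is the determinant
up to sign, so 0 is not an eigenvalue of an invertible matrix. *)
Lemma unitmx_factor_root0 (F : fieldType) (k : nat) (A : 'M[F]_k)
    (f : {poly F}) :
  A \in unitmx -> f %| char_poly A -> ~~ root f 0.
Proof.
move=> A_unit f_A; apply: contraL A_unit => f0.
have := root_dvdp f_A f0; rewrite rootE horner_coef0 char_poly_det.
rewrite mulf_eq0 signr_eq0 /= => /eqP detA.
by rewrite unitmxE detA unitr0.
Qed.

Lemma expn_sub1_gt0 (q d : nat) :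
  (1 < q)%N -> (0 < d)%N -> (0 < q ^ d - 1)%N.
Proof. by move=> q_gt1; rewrite subn_gt0 -(ltn_exp2l 0 d q_gt1). Qed.

Section LcmPeriod.

Variables (F : finFieldType) (g : {poly F}) (ks : seq nat).
Hypothesis degs_ks : irreducible_factor_degrees g ks.

Lemma lcm_period_gt0 : (0 < lcm_period #|F| ks)%N.
Proof.
have [_ degs] := degs_ks; rewrite /lcm_period big_seq.
apply: (big_ind (fun m => 0 < m)%N) => // [m n|d /degs[f [f_irr _] <-]].
  by rewrite lcmn_gt0 => -> ->.
have f_gt1 := fst f_irr; apply: expn_sub1_gt0; first exact: finNzRing_gt1.
by rewrite -ltnS prednK // ltnW.
Qed.

Lemma irreducible_factor_dvdp_XlcmB1 (f : {poly F}) :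
    irreducible_factor f g -> ~~ root f 0 ->
  f %| 'X^(lcm_period #|F| ks) - 1.
Proof.
have [_ degs] := degs_ks => f_fac f0; have [f_irr _] := f_fac.
apply: dvdp_trans (irreducible_dvdp_XexpB1 f_irr f0) _; apply: dvdp_XexpB1.
apply: (@dvdn_biglcm_seq _ _ (fun d => #|F| ^ d - 1)%N).
by apply/degs; exists f.
Qed.

End LcmPeriod.

Theorem theorem2 (p e q : nat) (hp : prime p) (he : (0 < e)%N)
    (hq : q = (p ^ e)%N)
    (F : finFieldType) (hF : #|F| = q)
    (k : nat) (hk : (0 < k)%N) (A : 'M[F]_k) (hA : A \in unitmx)
    (ks : seq nat) (hks : irreducible_factor_degrees (char_poly A) ks)
    (Q : nat) (hQ : Q = lcm_period q ks) :
  [/\ (forall f : {poly F}, irreducible_factor f (char_poly A) ->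
         multiplicity f (char_poly A) = 1%N) ->
      forall v : nat -> 'cV[F]_k, linear_solution A v -> periodic v Q,
      irreducible_poly (char_poly A) ->
      forall v : nat -> 'cV[F]_k, linear_solution A v ->
        periodic v (q ^ k - 1)%N
    & (exists2 f : {poly F}, irreducible_factor f (char_poly A) &
         (1 < multiplicity f (char_poly A))%N) ->
      forall (r : nat) (kappa : nat -> nat), base_expansion p (k - 1)%N r kappa ->
      forall v : nat -> 'cV[F]_k, linear_solution A v ->
        periodic v (Q * p ^ r.+1)%N ].
Proof.
have A_neq0 := char_poly_neq0 A.
have Q_gt0 : (0 < Q)%N by rewrite hQ -hF (lcm_period_gt0 hks).
have f_XQ (f : {poly F}) :
    irreducible_poly f -> f %| char_poly A -> f %| 'X^Q - 1.
  move=> f_irr f_A; rewrite hQ -hF.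
  apply: (irreducible_factor_dvdp_XlcmB1 hks) => //.
  exact: unitmx_factor_root0 f_A.
split.
- move=> mult1; apply: linear_solution_periodic => //.
  apply: dvdp_irreducible_powers => // f [|[|j]] f_irr fj_A.
  + by rewrite expr0 dvd1p.
  + exact: f_XQ.
  have f_A : f %| char_poly A by apply: dvdp_trans fj_A; rewrite exprS dvdp_mulIl.
  by have := leq_multiplicity (fst f_irr) A_neq0 fj_A; rewrite mult1.
- move=> A_irr; apply: linear_solution_periodic.
    by apply: expn_sub1_gt0; rewrite // -hF finNzRing_gt1.
  rewrite -hF -[k in (_ ^ k)%N]/(k.+1.-1) -(size_char_poly A).
  by apply: irreducible_dvdp_XexpB1 => //; apply: unitmx_factor_root0 (dvdpp _).
move=> _ r kappa k_exp; have pF : p \in [pchar F].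
  by apply: (@card_finPcharP _ p e) => //; rewrite hF.
apply: linear_solution_periodic.
  by rewrite muln_gt0 Q_gt0 expn_gt0 prime_gt0.
rewrite exprM -[X in _ - X](expr1n _ (p ^ r.+1)) -exprB_pchar ?pchar_poly //.
apply: dvdp_irreducible_powers => // f [|j] f_irr fj_A.
  by rewrite expr0 dvd1p.
have f_A : f %| char_poly A by apply: dvdp_trans fj_A; rewrite exprS dvdp_mulIl.
apply: dvdp_trans (dvdp_exp2r _ (f_XQ f f_irr f_A)); apply: dvdp_exp2l.
apply: leq_trans (base_expansion_ltn (prime_gt0 hp) k_exp).
have := leq_exp_dvdp (fst f_irr) A_neq0 fj_A.
by rewrite size_char_poly subn1 prednK.
Qed.
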